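(* Let a quaternionic Kähler NH-manifold $(M,H,G)$ be in some of the classes $\mathcal{W}_1\oplus\mathcal{W}_2$ (and in particular $\mathcal{W}_0$, $\mathcal{W}_1$ and $\mathcal{W}_2$), $\mathcal{W}_2\oplus\mathcal{W}_3$ and $\mathcal{W}_3$ with respect to both of the structures $J_2$ and $J_3$. Then $(M,H,G)$ is a flat hyper-Kähler NH-manifold. The unique class, in the classification by $\mathcal{W}_1,\mathcal{W}_2,\mathcal{W}_3$ with respect to $J_2$ and $J_3$, with some condition for $\nabla J_2$ and $\nabla J_3$ (i.e. other than the general class $\mathcal{W}_1\oplus\mathcal{W}_2\oplus\mathcal{W}_3$), where $(M,H,G)$ is not flat hyper-Kählerian, is $\mathcal{W}_1\oplus\mathcal{W}_3$, and its manifolds are determined by $$(\nabla_xJ_1)y=0,\qquad (\nabla_xJ_2)y=\omega_1(x)J_3y,\qquad (\nabla_xJ_3)y=-\omega_1(x)J_2y,$$ with $\omega_1(x)=-\theta_2(J_3x)=\theta_3(J_2x)$.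
   Context: $M$ is a differentiable manifold of dimension $4n$. An almost hypercomplex structure on $M$ is a triple $H=(J_1,J_2,J_3)$ of almost complex structures with $J_\alpha=J_\beta\circ J_\gamma=-J_\gamma\circ J_\beta$ and $J_\alpha^2=-I$ for all cyclic permutations $(\alpha,\beta,\gamma)$ of $(1,2,3)$. Put $\varepsilon_1=1$, $\varepsilon_2=\varepsilon_3=-1$. An NH-metric structure $G=(g,g_1,g_2,g_3)$ on $(M,H)$ consists of a pseudo-Riemannian metric $g$ of neutral signature $(2n,2n)$ with $g(x,y)=\varepsilon_\alpha g(J_\alpha x,J_\alpha y)$ for $\alpha=1,2,3$, together with $g_\alpha(x,y)=g(J_\alpha x,y)=-\varepsilon_\alpha g(x,J_\alpha y)$. $(M,H,G)$ is then an almost hypercomplex NH-manifold. Let $\nabla$ be the Levi-Civita connection of $g$. $(M,H,G)$ is a quaternionic Kähler NH-manifold if there are local 1-forms $\omega_1,\omega_2,\omega_3$ with $(\nabla_xJ_\alpha)y=\omega_\gamma(x)J_\beta y-\omega_\beta(x)J_\gamma y$ for all cyclic permutations $(\alpha,\beta,\gamma)$ of $(1,2,3)$. It is a hyper-Kähler NH-manifold if $\nabla J_\alpha=0$ for $\alpha=1,2,3$. Flat means the curvature tensor of $\nabla$ vanishes. Let $F_\alpha(x,y,z)=g((\nabla_xJ_\alpha)y,z)$ and $\theta_\alpha(z)=g^{ij}F_\alpha(e_i,e_j,z)$ for a basis $\{e_i\}$ of the tangent space; $\mathfrak{S}$ denotes the cyclic sum over $x,y,z$. For $\alpha=2,3$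 the classes are defined by the following conditions on $F_\alpha$, within the space of tensors satisfying $F(x,y,z)=F(x,z,y)=F(x,J_\alpha y,J_\alpha z)$: $\mathcal{W}_0(J_\alpha)$: $F_\alpha=0$; $\mathcal{W}_1(J_\alpha)$: $F_\alpha(x,y,z)=\frac{1}{4n}\{g(x,y)\theta_\alpha(z)+g(x,z)\theta_\alpha(y)+g(x,J_\alpha y)\theta_\alpha(J_\alpha z)+g(x,J_\alpha z)\theta_\alpha(J_\alpha y)\}$; $\mathcal{W}_2(J_\alpha)$: $\mathfrak{S}_{x,y,z}F_\alpha(x,y,J_\alpha z)=0$ and $\theta_\alpha=0$; $\mathcal{W}_3(J_\alpha)$: $\mathfrak{S}_{x,y,z}F_\alpha(x,y,z)=0$. $(M,H,G)$ belongs to $(\mathcal{W}_i\oplus\mathcal{W}_j)(J_\alpha)$ if at each point $F_\alpha$ is a sum of a tensor satisfying the $\mathcal{W}_i(J_\alpha)$ condition and one satisfying the $\mathcal{W}_j(J_\alpha)$ condition.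
   Formalization: Existence of non-flat-hyper-Kähler manifolds in W1⊕W3, and the converse reading of ''determined by'', are left out as false: W1⊕W3 forces ω1(J3 e)=0 on an adapted basis, so ω1=0. Only elimination of the other proper classes and the equations for W1⊕W3 are stated. *)

(* Defs.v *)
From mathcomp Require Import all_boot all_order all_algebra.
From mathcomp Require Import all_classical all_reals all_analysis.

Set Implicit Arguments.
Unset Strict Implicit.
Unset Printing Implicit Defensive.
Import Order.TTheory GRing.Theory Num.Theory.
Import numFieldNormedType.Exports.
Local Open Scope classical_set_scope.
Local Open Scope ring_scope.

(* Geometry on an m-dimensional manifold is expressed in charts.  The chart c
   identifies the tangent space at a point with 'cV[R]_m through the coordinate
   basis e_i = delta_mx i 0.  A tensor field is the family, over the charts, of
   its component matrices as functions of the coordinates, subject to the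
   tensorial transformation law and to smoothness.  Vectors are columns, so that
   composition of endomorphisms is *m. *)

Section Smoothness.
Variables (R : realType) (m : nat).
Implicit Types (O : set 'cV[R]_m) (x : 'cV[R]_m).

Definition ebase (i : 'I_m) : 'cV[R]_m := delta_mx i 0.

(* On an open O: f and all its partial derivatives up to order k exist and are
   continuous.  Values of f outside O play no role. *)
Fixpoint Ck (k : nat) O (f : 'cV[R]_m -> R) : Prop :=
  (forall x, O x -> {for x, continuous f}) /\
  if k is k'.+1 then
    forall i, (forall x, O x -> derivable f x (ebase i)) /\
              Ck k' O ('D_(ebase i) f)
  else True.

Definition smooth_on O f := forall k, Ck k O f.

Definition smooth_mx_on O p q (f : 'cV[R]_m -> 'M[R]_(p, q)) :=
  forall i j, smooth_on O (fun x => f x i j).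

Definition partial_mx (i : 'I_m) p q (f : 'cV[R]_m -> 'M[R]_(p, q)) x
    : 'M[R]_(p, q) :=
  \matrix_(k, l) 'D_(ebase i) (fun y => f y k l) x.

Definition jac (t : 'cV[R]_m -> 'cV[R]_m) x : 'M[R]_m :=
  \matrix_(a, i) 'D_(ebase i) (fun y => t y a 0) x.

End Smoothness.

Section Manifold.
Variables (R : realType) (M : topologicalType) (m : nat).

Record chart := Chart {
  cdom : set M;
  cmap : M -> 'cV[R]_m;
  cinv : 'cV[R]_m -> M;
  cdom_open : open cdom;
  cimg_open : open (cmap @` cdom);
  cmapK : forall p, cdom p -> cinv (cmap p) = p;
  cmap_cont : forall p, cdom p -> {for p, continuous cmap};
  cinv_cont : forall x, (cmap @` cdom) x -> {for x, continuous cinv}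
}.

(* coordinates, in the chart c, of the points of W lying in its domain *)
Definition coords (c : chart) (W : set M) := cmap c @` (cdom c `&` W).

Definition transition (c c' : chart) := cmap c' \o cinv c.

Record smooth_manifold (A : set chart) : Prop := SmoothManifold {
  _ : hausdorff_space M;
  _ : @second_countable M;
  _ : forall p, exists2 c, A c & cdom c p;
  _ : forall c c', A c -> A c' ->
        smooth_mx_on (coords c (cdom c')) (transition c c')
}.

Definition tfield p q := chart -> 'cV[R]_m -> 'M[R]_(p, q).

(* [law B T T'] relates the components T in one chart to the components T' in
   another one, B being the Jacobian matrix of the change of coordinates. *)
Definition tensor_on (p q : nat)
    (law : 'M[R]_m -> 'M[R]_(p, q) -> 'M[R]_(p, q) -> Prop)
    (A : set chart) (W : set M) (T : tfield p q) : Prop :=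
  (forall c, A c -> smooth_mx_on (coords c W) (T c)) /\
  (forall c c' x, A c -> A c' -> coords c (cdom c' `&` W) x ->
     law (jac (transition c c') x) (T c x) (T c' (transition c c' x))).

(* (1,1)-tensor: components E k j = E^k_j *)
Definition endo_on := @tensor_on m m (fun B E E' => B *m E = E' *m B).
(* (0,2)-tensor: components b i j = b(e_i, e_j) *)
Definition form2_on := @tensor_on m m (fun B b b' => b = B^T *m b' *m B).
(* 1-form: components w 0 j = w(e_j) *)
Definition form1_on := @tensor_on 1 m (fun B w w' => w = w' *m B).

Definition form2 (b : 'M[R]_m) (u v : 'cV[R]_m) : R := (u^T *m b *m v) 0 0.
Definition form1 (w : 'rV[R]_m) (u : 'cV[R]_m) : R := (w *m u) 0 0.

(* Affine connections: Gam c x i is the matrix of v |-> nabla_{e_i} v on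
   constant v, i.e. (Gam c x i) k j = Gamma^k_{ij}. *)
Definition connection_coef := chart -> 'cV[R]_m -> 'I_m -> 'M[R]_m.

Definition affine_connection (A : set chart) (Gam : connection_coef) : Prop :=
  (forall c i, A c -> smooth_mx_on (coords c setT) (fun x => Gam c x i)) /\
  (forall c c' x i, A c -> A c' -> coords c (cdom c') x ->
     let t := transition c c' in
     jac t x *m Gam c x i =
       partial_mx i (jac t) x
       + (\sum_b jac t x b i *: Gam c' (t x) b) *m jac t x).

Definition torsion_free (A : set chart) (Gam : connection_coef) : Prop :=
  forall c x i j k, A c -> coords c setT x -> Gam c x i k j = Gam c x j k i.

(* d_i g(e_j, e_l) = g(nabla_i e_j, e_l) + g(e_j, nabla_i e_l) *)
Definition metric_connection (A : set chart) (g : tfield m m)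
    (Gam : connection_coef) : Prop :=
  forall c x i, A c -> coords c setT x ->
    partial_mx i (g c) x = (Gam c x i)^T *m g c x + g c x *m Gam c x i.

Definition levi_civita (A : set chart) (g : tfield m m)
    (Gam : connection_coef) : Prop :=
  [/\ affine_connection A Gam, torsion_free A Gam & metric_connection A g Gam].

(* nabla_u E = sum_i u^i (d_i E + Gamma_i E - E Gamma_i) *)
Definition nabla_endo (Gam : connection_coef) (E : tfield m m) (c : chart)
    (x u : 'cV[R]_m) : 'M[R]_m :=
  \sum_i u i 0 *: (partial_mx i (E c) x + Gam c x i *m E c x
                   - E c x *m Gam c x i).

(* the endomorphism R(u, v) = nabla_u nabla_v - nabla_v nabla_u - nabla_[u,v] *)
Definition curvature (Gam : connection_coef) (c : chart) (x u v : 'cV[R]_m)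
    : 'M[R]_m :=
  \sum_i \sum_j (u i 0 * v j 0) *:
    (partial_mx i (fun y => Gam c y j) x - partial_mx j (fun y => Gam c y i) x
     + Gam c x i *m Gam c x j - Gam c x j *m Gam c x i).

Definition flat (A : set chart) (Gam : connection_coef) : Prop :=
  forall c x u v, A c -> coords c setT x -> curvature Gam c x u v = 0.

End Manifold.

(* J_1, J_2, J_3 (and W_1, W_2, W_3) are indexed by 'I_3, with its addition
   modulo 3: the cyclic permutations of (1,2,3) are (a, a + 1, a + 2). *)
Definition ix1 : 'I_3 := 0.
Definition ix2 : 'I_3 := 1.
Definition ix3 : 'I_3 := 1 + 1.

Definition eps (R : realType) (a : 'I_3) : R := if a == ix1 then 1 else -1.

(* Algebraic classification, on a tangent space 'cV_(4n) with scalar product b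
   and endomorphism E in {J_2, J_3}. *)
Section Classes.
Variables (R : realType) (n : nat).
Local Notation m := (4 * n)%N.
Local Notation V := 'cV[R]_m.
Variables (b E : 'M[R]_m).
Implicit Types (F : V -> V -> V -> R).
Let g := form2 b.
Let J (u : V) : V := E *m u.

Definition trilinear F : Prop :=
  [/\ forall y z, scalar (fun x => F x y z),
      forall x z, scalar (fun y => F x y z) &
      forall x y, scalar (fun z => F x y z)].

Definition Fspace F : Prop :=
  [/\ trilinear F, forall x y z, F x y z = F x z y &
      forall x y z, F x y z = F x (J y) (J z)].

(* theta(z) = g^{ij} F(e_i, e_j, z) *)
Definition theta F (z : V) : R :=
  \sum_i \sum_j invmx b i j * F (ebase R i) (ebase R j) z.

Definition W1 F : Prop := forall x y z,
  F x y z = m%:R^-1 *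
    (g x y * theta F z + g x z * theta F y
     + g x (J y) * theta F (J z) + g x (J z) * theta F (J y)).

Definition W2 F : Prop :=
  (forall x y z, F x y (J z) + F y z (J x) + F z x (J y) = 0) /\
  (forall z, theta F z = 0).

Definition W3 F : Prop := forall x y z, F x y z + F y z x + F z x y = 0.

Definition Wi (i : 'I_3) : (V -> V -> V -> R) -> Prop :=
  if i == ix1 then W1 else if i == ix2 then W2 else W3.

(* F lies in the direct sum of the W_i, i in S; the empty S gives W_0. *)
Definition in_Wsum (S : {set 'I_3}) F : Prop :=
  exists P : 'I_3 -> V -> V -> V -> R,
    (forall i, i \in S -> Fspace (P i) /\ Wi i (P i)) /\
    (forall x y z, F x y z = \sum_(i in S) P i x y z).

End Classes.

Section NHManifold.
Variables (R : realType) (n : nat) (M : topologicalType).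
Local Notation m := (4 * n)%N.
Variables (A : set (chart R M m)) (J : 'I_3 -> tfield R M m m m).

Definition almost_hypercomplex : Prop :=
  [/\ forall a, endo_on A setT (J a),
      forall a c x, A c -> coords c setT x -> J a c x *m J a c x = (-1)%:M,
      forall a c x, A c -> coords c setT x ->
        J a c x = J (a + 1) c x *m J (a + 1 + 1) c x &
      forall a c x, A c -> coords c setT x ->
        J a c x = - (J (a + 1 + 1) c x *m J (a + 1) c x)].

Variables (g : tfield R M m m m) (gs : 'I_3 -> tfield R M m m m).

(* signature (2n,2n): congruent to the diagonal matrix with 2n entries 1
   followed by 2n entries -1 *)
Definition neutral (b : 'M[R]_m) : Prop :=
  exists2 P : 'M[R]_m, P \in unitmx &
    P^T *m b *m P = diag_mx (\row_(i < m) (if (i < 2 * n)%N then 1 else -1)).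

(* G = (g, g_1, g_2, g_3) with g_a = gs a *)
Record nh_metric : Prop := NHMetric {
  _ : form2_on A setT g;
  _ : forall c x, A c -> coords c setT x -> (g c x)^T = g c x;
  _ : forall c x, A c -> coords c setT x -> neutral (g c x);
  _ : forall a c x u v, A c -> coords c setT x ->
        form2 (g c x) u v =
        eps R a * form2 (g c x) (J a c x *m u) (J a c x *m v);
  _ : forall a c x u v, A c -> coords c setT x ->
        form2 (gs a c x) u v = form2 (g c x) (J a c x *m u) v /\
        form2 (gs a c x) u v = - (eps R a * form2 (g c x) u (J a c x *m v))
}.

Variable (Gam : connection_coef R M m).

Definition hyper_kahler : Prop :=
  forall a c x u, A c -> coords c setT x -> nabla_endo Gam (J a) c x u = 0.

(* om a, for a = 1, 2, 3, are 1-forms on W with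
   (nabla_u J_a) v = om_c(u) J_b v - om_b(u) J_c v, (a,b,c) cyclic. *)
Definition qk_forms (W : set M) (om : 'I_3 -> tfield R M m 1 m) : Prop :=
  (forall a, form1_on A W (om a)) /\
  (forall a c (x u v : 'cV[R]_m), A c -> coords c W x ->
     nabla_endo Gam (J a) c x u *m v =
       form1 (om (a + 1 + 1) c x) u *: (J (a + 1) c x *m v)
       - form1 (om (a + 1) c x) u *: (J (a + 1 + 1) c x *m v)).

Definition quaternionic_kahler : Prop :=
  forall p : M, exists (W : set M) (om : 'I_3 -> tfield R M m 1 m),
    [/\ open W, W p & qk_forms W om].

Definition Ften (a : 'I_3) (c : chart R M m) (x u v w : 'cV[R]_m) : R :=
  form2 (g c x) (nabla_endo Gam (J a) c x u *m v) w.

Definition thetaJ (a : 'I_3) (c : chart R M m) (x : 'cV[R]_m)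
    : 'cV[R]_m -> R :=
  theta (g c x) (Ften a c x).

Definition in_class (a : 'I_3) (S : {set 'I_3}) : Prop :=
  forall c x, A c -> coords c setT x ->
    in_Wsum (g c x) (J a c x) S (Ften a c x).

Definition in_class23 (S : {set 'I_3}) : Prop :=
  in_class ix2 S /\ in_class ix3 S.

End NHManifold.

(* Main.v *)
Require Import Defs.
From mathcomp Require Import all_boot all_order all_algebra.
From mathcomp Require Import all_classical all_reals all_analysis.
From mathcomp Require Import ring lra.

Set Implicit Arguments.
Unset Strict Implicit.
Unset Printing Implicit Defensive.
Import Order.TTheory GRing.Theory Num.Theory.
Import numFieldNormedType.Exports.
Local Open Scope classical_set_scope.
Local Open Scope ring_scope.

(** The endomorphism J_1 is skew for g, while J_2 and J_3 are symmetric.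
Covariant differentiation preserves these symmetries because nabla g = 0
[nabla_coef_adjoint].  Hence in
  nabla J_2 = om_1 J_3 - om_3 J_1,   nabla J_3 = om_2 J_1 - om_1 J_2
the skew terms vanish, which forces om_2 = om_3 = 0 [om2_0, om3_0].  So
nabla J_1 = 0 and the whole structure is governed by om_1:
F_2(x,y,z) = om_1(x) g(J_3 y, z), and taking the trace gives
theta_2(z) = om_1(J_3 z) [theta2E]; likewise for J_3 [theta3E].  These are
the formulas of the class W_1 + W_3.

A sum of classes that omits W_1 or W_3 forces om_1 = 0:
- tensors in W_2 + W_3 have zero trace theta [class23_theta], and
  theta_2 = om_1 o J_3 with J_3 invertible;
- tensors in W_1 + W_2 have zero cyclic sum of F(x,y,Jz) [class12_cyclic];
  here F_2(x,y,J_2 z) = om_1(x) c(y,z) with c the nondegenerate 2-form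
  - g(., J_1 .), so that om_1 /\ c = 0, and contracting with the inverse of c
  gives (4n - 2) om_1 = 0 [wedge_nondeg0].
Every proper subset of the three classes other than W_1 + W_3 omits W_1 or
W_3, and om_1 = 0 says that the manifold is hyper-Kaehler.

A hyper-Kaehler NH-manifold is flat for an algebraic reason
[anticommuting_curvature0].  The curvature commutes with the g-symmetric
structures J_2 and J_3; by the Bianchi identity and the pair symmetry each of
them can then be moved freely between the slots of R(x,y,z,w).  Moving J_2 and
J_3 past each other replaces J_2 J_3 by J_3 J_2 = - J_2 J_3, hence R = 0.

That the curvature commutes with parallel endomorphisms and is skew for g
rests on the equality of mixed partial derivatives, which is derived from the
mean value theorem [derive_commute]. *)

(** * Equality of mixed partial derivatives *)

Section MixedDerivatives.
Variables (R : realType) (V : normedModType R).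
Implicit Types (f : V -> R) (O : set V) (u v x : V).

Lemma is_derive_line f x u t : derivable f (x + t *: u) u ->
  is_derive t 1 (fun s => f (x + s *: u)) ('D_u f (x + t *: u)).
Proof.
move=> df.
have E : (fun h => h^-1 *: (((fun s => f (x + s *: u)) \o shift t) (h *: 1)
              - (fun s => f (x + s *: u)) t)) =
      (fun h => h^-1 *: ((f \o shift (x + t *: u)) (h *: u) - f (x + t *: u))).
  apply: funext => h /=; congr (_ *: (f _ - _)).
  by rewrite scalerDl -[h *: 1]/(h * 1) mulr1 addrCA.
by split; rewrite /derivable /derive E.
Qed.

(** The mean value theorem is applied to t |-> f (x + t u + h v) - f (x + t
u), and then to the derivative along u as a function of the position along v.
*)
Lemma second_difference f x u v h : 0 < h ->
  (forall a b, 0 <= a <= h -> 0 <= b <= h ->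
     derivable f (x + a *: u + b *: v) u /\
     derivable ('D_u f) (x + a *: u + b *: v) v) ->
  exists a b, [/\ 0 <= a <= h, 0 <= b <= h &
    f (x + h *: u + h *: v) - f (x + h *: u) - f (x + h *: v) + f x
      = h * h * 'D_v ('D_u f) (x + a *: u + b *: v)].
Proof.
move=> h0 df.
have h01 : 0 <= h <= h by rewrite lexx ltW.
have h00 : 0 <= (0 : R) <= h by rewrite lexx ltW.
pose phi t := f ((x + h *: v) + t *: u) - f (x + t *: u).
pose dphi t := 'D_u f ((x + h *: v) + t *: u) - 'D_u f (x + t *: u).
have Dphi t : 0 <= t <= h -> is_derive t 1 phi (dphi t).
  move=> th; apply: is_deriveB; apply: is_derive_line.
    by rewrite addrAC; exact: (df _ _ th h01).1.
  by move: (df _ _ th h00).1; rewrite scale0r addr0; exact.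
have [||a ah phiE] := @MVT_segment R phi dphi 0 h (ltW h0).
- by move=> t /[!in_itv]/= /andP[t0 th]; apply: Dphi; rewrite !ltW.
- apply: derivable_within_continuous => t /[!in_itv]/= th.
  by have [] := Dphi t th.
rewrite in_itv /= in ah.
pose psi t := 'D_u f ((x + a *: u) + t *: v).
pose dpsi t := 'D_v ('D_u f) ((x + a *: u) + t *: v).
have Dpsi t : 0 <= t <= h -> is_derive t 1 psi (dpsi t).
  by move=> th; apply: is_derive_line; have [] := df _ _ ah th.
have [||b bh psiE] := @MVT_segment R psi dpsi 0 h (ltW h0).
- by move=> t /[!in_itv]/= /andP[t0 th]; apply: Dpsi; rewrite !ltW.
- apply: derivable_within_continuous => t /[!in_itv]/= th.
  by have [] := Dpsi t th.
rewrite in_itv /= in bh.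
exists a, b; split=> //; move: phiE psiE.
rewrite /phi /dphi /psi /dpsi !scale0r !addr0 subr0.
rewrite ![x + h *: v + _]addrAC => phiE psiE.
by rewrite [RHS]mulrC mulrA -psiE -phiE; ring.
Qed.

Lemma square_in_nbhs (N : set V) x u v : nbhs x N ->
  exists2 h : R, 0 < h & forall a b, 0 <= a <= h -> 0 <= b <= h ->
    N (x + a *: u + b *: v).
Proof.
move=> /nbhs_ballP[e /= e0 eN].
have D0 : 0 < `|u| + `|v| + 1 by rewrite ltr_wpDl // addr_ge0.
pose h := e / (`|u| + `|v| + 1).
exists h; first exact: divr_gt0.
move=> a b /andP[a0 ah] /andP[b0 bh].
apply: eN; rewrite -ball_normE /= -addrA opprD addNKr normrN.
apply: (le_lt_trans (ler_normD _ _)); rewrite !normrZ !ger0_norm //.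
have hE : h * (`|u| + `|v| + 1) = e by rewrite /h divfK // gt_eqF.
have h0 : 0 < h by rewrite divr_gt0.
have := ler_wpM2r (normr_ge0 u) ah; have := ler_wpM2r (normr_ge0 v) bh.
lra.
Qed.

Lemma norm_sub_mid (p q r e : R) :
  `|p - r| < e / 2 -> `|q - r| < e / 2 -> `|p - q| <= e.
Proof.
by rewrite !ltr_norml ler_norml => /andP[p1 p2] /andP[q1 q2]; lra.
Qed.

(** The second difference of f on the square with sides h u and h v equals h^2
times a value of either mixed derivative; both are continuous at x, and the
square shrinks to x. *)
Lemma derive_commute O f u v x : open O -> O x ->
  (forall y, O y -> derivable f y u) ->
  (forall y, O y -> derivable f y v) ->
  (forall y, O y -> derivable ('D_u f) y v) ->
  (forall y, O y -> derivable ('D_v f) y u) ->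
  {for x, continuous ('D_v ('D_u f))} ->
  {for x, continuous ('D_u ('D_v f))} ->
  'D_v ('D_u f) x = 'D_u ('D_v f) x.
Proof.
move=> oO Ox fu fv fuv fvu cuv cvu.
apply/eqP; rewrite -subr_eq0 -normr_le0.
apply/ler_addgt0Pl => e e0; rewrite addr0.
have e20 : 0 < e / 2 by rewrite divr_gt0.
move/cvgrPdist_lt/(_ _ e20) : cuv => Nuv.
move/cvgrPdist_lt/(_ _ e20) : cvu => Nvu.
have [h h0 hN] := square_in_nbhs u v
  (filterI (open_nbhs_nbhs (conj oO Ox)) (filterI Nuv Nvu)).
have [a [b [ah bh E1]]] : exists a b, [/\ 0 <= a <= h, 0 <= b <= h &
    f (x + h *: u + h *: v) - f (x + h *: u) - f (x + h *: v) + f x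
      = h * h * 'D_v ('D_u f) (x + a *: u + b *: v)].
  apply: second_difference => // a b ah bh; have [Oab _] := hN a b ah bh.
  by split; [apply: fu | apply: fuv].
(* the same second difference, with the roles of u and v exchanged *)
have [a' [b' [a'h b'h E2]]] : exists a b, [/\ 0 <= a <= h, 0 <= b <= h &
    f (x + h *: u + h *: v) - f (x + h *: u) - f (x + h *: v) + f x
      = h * h * 'D_u ('D_v f) (x + a *: u + b *: v)].
  have [|b' [a' [b'h a'h E2]]] := @second_difference f x v u h h0.
    move=> b' a' b'h a'h; have [Oab _] := hN a' b' a'h b'h.
    by rewrite addrAC; split; [apply: fv | apply: fvu].
  exists a', b'; split; [exact: a'h | exact: b'h | rewrite
    (addrAC x (a' *: u)) -E2 (addrAC x (h *: u))].
  exact: (congr1 (fun z => z + f x) (addrAC _ _ _)).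
have E : 'D_v ('D_u f) (x + a *: u + b *: v)
       = 'D_u ('D_v f) (x + a' *: u + b' *: v).
  apply: (@mulfI _ (h * h)); first by rewrite mulf_neq0 ?gt_eqF.
  exact: etrans (esym E1) E2.
have [_ [/= H1 _]] := hN a b ah bh.
have [_ [_ /= H2]] := hN a' b' a'h b'h.
rewrite E in H1.
exact: (norm_sub_mid H1 H2).
Qed.

End MixedDerivatives.

(** * Differentiation of matrix-valued functions *)

Section MatrixCalculus.
Variables (R : realType) (m : nat).
Local Notation V := 'cV[R]_m.
Implicit Types (O : set V) (x : V) (i j : 'I_m).

Lemma addmxE p q (B C : 'M[R]_(p, q)) k l : (B + C) k l = B k l + C k l.
Proof. by rewrite mxE. Qed.

Lemma oppmxE p q (B : 'M[R]_(p, q)) k l : (- B) k l = - B k l.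
Proof. by rewrite mxE. Qed.

Lemma smooth_on_derive O (f : V -> R) i :
  smooth_on O f -> smooth_on O ('D_(ebase R i) f).
Proof. by move=> sf k; have [_ /(_ i)[]] := sf k.+1. Qed.

Lemma smooth_on_derivable O (f : V -> R) i x :
  smooth_on O f -> O x -> derivable f x (ebase R i).
Proof. by move=> sf Ox; have [_ /(_ i)[+ _]] := sf 1%N; apply. Qed.

Lemma smooth_on_continuous O (f : V -> R) x :
  smooth_on O f -> O x -> {for x, continuous f}.
Proof. by move=> sf; have [+ _] := sf 0%N; apply. Qed.

Lemma partial_mx_entry i p q (f : V -> 'M[R]_(p, q)) x k l :
  partial_mx i f x k l = 'D_(ebase R i) (fun y => f y k l) x.
Proof. by rewrite mxE. Qed.

Lemma partial_mxE i p q (f : V -> 'M[R]_(p, q)) k l :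
  (fun y => partial_mx i f y k l) = 'D_(ebase R i) (fun y => f y k l).
Proof. by apply: funext => y; exact: partial_mx_entry. Qed.

Lemma partial2_mxE i j p q (f : V -> 'M[R]_(p, q)) x k l :
  partial_mx i (partial_mx j f) x k l =
  'D_(ebase R i) ('D_(ebase R j) (fun y => f y k l)) x.
Proof. by rewrite -partial_mxE; exact: partial_mx_entry. Qed.

Lemma derive_commute_smooth O i j (f : V -> R) x :
  open O -> O x -> smooth_on O f ->
  'D_(ebase R i) ('D_(ebase R j) f) x = 'D_(ebase R j) ('D_(ebase R i) f) x.
Proof.
move=> oO Ox s; have si := smooth_on_derive i s.
have sj := smooth_on_derive j s.
apply: (derive_commute oO Ox) => [y Oy|y Oy|y Oy|y Oy||].
- exact: smooth_on_derivable s Oy.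
- exact: smooth_on_derivable s Oy.
- exact: smooth_on_derivable sj Oy.
- exact: smooth_on_derivable si Oy.
- exact: smooth_on_continuous (smooth_on_derive i sj) Ox.
- exact: smooth_on_continuous (smooth_on_derive j si) Ox.
Qed.

Lemma partial_mxC O i j p q (f : V -> 'M[R]_(p, q)) x :
  open O -> O x -> smooth_mx_on O f ->
  partial_mx i (partial_mx j f) x = partial_mx j (partial_mx i f) x.
Proof.
move=> oO Ox sf; apply/matrixP => k l.
apply: etrans (partial2_mxE i j f x k l) _.
apply: etrans _ (esym (partial2_mxE j i f x k l)).
exact: (derive_commute_smooth i j oO Ox (sf k l)).
Qed.

(** Identities between tensor fields hold on the image of a chart only, so
they are differentiated as identities on an open set. *)
Lemma partial_mx_local O i p q (f h : V -> 'M[R]_(p, q)) x :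
  open O -> O x -> (forall y, O y -> f y = h y) ->
  partial_mx i f x = partial_mx i h x.
Proof.
move=> oO Ox fh; apply/matrixP => k l; rewrite !mxE.
apply: near_eq_derive; near=> y; rewrite fh //; near: y.
exact: open_nbhs_nbhs.
Unshelve. all: by end_near. Qed.

Definition derivable_mx i p q (f : V -> 'M[R]_(p, q)) x :=
  forall k l, derivable (fun y => f y k l) x (ebase R i).

Lemma smooth_mx_derivable O i p q (f : V -> 'M[R]_(p, q)) x :
  smooth_mx_on O f -> O x -> derivable_mx i f x.
Proof. by move=> sf Ox k l; exact: smooth_on_derivable (sf k l) Ox. Qed.

Lemma partial_mxD i p q (f h : V -> 'M[R]_(p, q)) x :
  derivable_mx i f x -> derivable_mx i h x ->
  partial_mx i (fun y => f y + h y) x = partial_mx i f x + partial_mx i h x.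
Proof.
move=> df dh; apply/matrixP => k l; rewrite addmxE [LHS]mxE.
rewrite [X in 'D__ X x](_ : _ = (fun y => f y k l) + (fun y => h y k l)).
  by rewrite deriveD // !mxE.
by apply: funext => y; rewrite mxE.
Qed.

Lemma partial_mxN i p q (f : V -> 'M[R]_(p, q)) x :
  derivable_mx i f x ->
  partial_mx i (fun y => - f y) x = - partial_mx i f x.
Proof.
move=> df; apply/matrixP => k l; rewrite oppmxE [LHS]mxE.
rewrite [X in 'D__ X x](_ : _ = - (fun y => f y k l)).
  by rewrite deriveN // mxE.
by apply: funext => y; rewrite mxE.
Qed.

Lemma partial_mxZ i p q (f : V -> 'M[R]_(p, q)) s x :
  derivable_mx i f x ->
  partial_mx i (fun y => s *: f y) x = s *: partial_mx i f x.
Proof.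
move=> df; apply/matrixP => k l; rewrite partial_mx_entry [RHS]mxE.
rewrite partial_mx_entry.
rewrite [X in 'D__ X x](_ : _ = s *: (fun y => f y k l)).
  by rewrite deriveZ.
by apply: funext => y; rewrite mxE.
Qed.

Lemma derivable_mxN i p q (f : V -> 'M[R]_(p, q)) x :
  derivable_mx i f x -> derivable_mx i (fun y => - f y) x.
Proof.
move=> df k l.
rewrite [X in derivable X](_ : _ = - (fun y => f y k l)).
  exact: derivableN.
by apply: funext => y; rewrite mxE.
Qed.

Lemma derivable_mx_tr i p q (f : V -> 'M[R]_(p, q)) x :
  derivable_mx i f x -> derivable_mx i (fun y => (f y)^T) x.
Proof.
move=> df k l; rewrite [X in derivable X](_ : _ = (fun y => f y l k)) //.
by apply: funext => y; rewrite mxE.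
Qed.

Lemma partial_mx_tr i p q (f : V -> 'M[R]_(p, q)) x :
  partial_mx i (fun y => (f y)^T) x = (partial_mx i f x)^T.
Proof.
apply/matrixP => k l; rewrite !mxE.
rewrite [X in 'D__ X x](_ : _ = (fun y => f y l k)) //.
by apply: funext => y; rewrite mxE.
Qed.

Lemma is_derive_mulmx i p q r (f : V -> 'M[R]_(p, q))
    (h : V -> 'M[R]_(q, r)) x k l :
  derivable_mx i f x -> derivable_mx i h x ->
  is_derive x (ebase R i) (fun y => (f y *m h y) k l)
    ((partial_mx i f x *m h x + f x *m partial_mx i h x) k l).
Proof.
move=> df dh.
pose F (j : 'I_q) y := f y k j * h y j l.
pose dF (j : 'I_q) :=
  f x k j *: partial_mx i h x j l + h x j l *: partial_mx i f x k j.
have isF (j : 'I_q) : is_derive x (ebase R i) (F j) (dF j).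
  rewrite /dF /partial_mx [in X in is_derive _ _ _ X]mxE.
  rewrite [in X in is_derive _ _ _ X]mxE.
  have df' := derivableP (df k j); have dh' := derivableP (dh j l).
  exact: is_deriveM.
have -> : (fun y => (f y *m h y) k l) = \sum_(j < q) F j.
  by apply: funext => y; rewrite fct_sumE mxE.
apply: is_derive_eq.
rewrite addmxE mxE [X in _ = _ + X]mxE -big_split /=.
by apply: eq_bigr => j _; rewrite /dF [LHS]addrC; congr (_ + _); exact: mulrC.
Qed.

Lemma partial_mxM i p q r (f : V -> 'M[R]_(p, q)) (h : V -> 'M[R]_(q, r)) x :
  derivable_mx i f x -> derivable_mx i h x ->
  partial_mx i (fun y => f y *m h y) x
    = partial_mx i f x *m h x + f x *m partial_mx i h x.
Proof.
move=> df dh; apply/matrixP => k l; rewrite [LHS]mxE.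
by have [_ ->] := is_derive_mulmx k l df dh.
Qed.

Lemma derivable_mxM i p q r (f : V -> 'M[R]_(p, q)) (h : V -> 'M[R]_(q, r)) x :
  derivable_mx i f x -> derivable_mx i h x ->
  derivable_mx i (fun y => f y *m h y) x.
Proof. by move=> df dh k l; have [] := is_derive_mulmx k l df dh. Qed.

End MatrixCalculus.

(** * Covariant derivative and curvature in a chart *)

Section Connection.
Variables (R : realType) (m : nat) (O : set 'cV[R]_m).
Hypothesis oO : open O.
Implicit Types (x : 'cV[R]_m) (i j k : 'I_m) (Ga : 'cV[R]_m -> 'I_m -> 'M[R]_m).

Definition curv_coef Ga x i j : 'M[R]_m :=
  partial_mx i (fun y => Ga y j) x - partial_mx j (fun y => Ga y i) x
  + Ga x i *m Ga x j - Ga x j *m Ga x i.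

(** The system d_k T = T B_k - A_k T says that T is parallel when A and B are
the connection coefficients on its target and source. Its integrability
condition d_i d_j T = d_j d_i T is the conclusion. With A = B the endomorphism
T commutes with the curvature; with A = - B^T the bilinear form T is preserved
by it. *)
Lemma parallel_intertwines_curv A B (T : 'cV[R]_m -> 'M[R]_m) x i j :
  O x -> smooth_mx_on O T ->
  (forall k l, derivable_mx k (A^~ l) x) ->
  (forall k l, derivable_mx k (B^~ l) x) ->
  (forall y k, O y -> partial_mx k T y = T y *m B y k - A y k *m T y) ->
  T x *m curv_coef B x i j = curv_coef A x i j *m T x.
Proof.
move=> Ox sT dA dB ET.
have dT k : derivable_mx k T x by exact: smooth_mx_derivable sT Ox.
have E k l : partial_mx k (partial_mx l T) x =
    (T x *m B x k - A x k *m T x) *m B x l + T x *m partial_mx k (B^~ l) x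
    - (partial_mx k (A^~ l) x *m T x
       + A x l *m (T x *m B x k - A x k *m T x)).
  rewrite (partial_mx_local k oO Ox (fun y => ET y l)).
  rewrite partial_mxD; first last.
  - by move=> a b; apply: (derivable_mxN (derivable_mxM (dA k l) (dT k))).
  - exact: derivable_mxM.
  rewrite partial_mxN; last exact: derivable_mxM.
  by rewrite !partial_mxM // ET.
have := partial_mxC i j oO Ox sT; rewrite !E {E} /curv_coef.
move: (partial_mx i (A^~ j) x) (partial_mx j (A^~ i) x).
move: (partial_mx i (B^~ j) x) (partial_mx j (B^~ i) x).
(* After expansion the entries of the products are atoms of a linear identity. *)
move: (T x) (A x i) (A x j) (B x i) (B x j) => t ai aj bi bj dbi dbj dai daj H.
apply/matrixP => k l; have /matrixP/(_ k l) {H} := H.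
rewrite !(mulmxDl, mulmxDr, mulNmx, mulmxN, mulmxA, addmxE, oppmxE).
move=> H; lra.
Qed.

Lemma curv_coefN Ga x i j : curv_coef Ga x j i = - curv_coef Ga x i j.
Proof.
by apply/matrixP => k l; rewrite /curv_coef !(addmxE, oppmxE); ring.
Qed.

(** The dual connection - Ga^T has curvature - K^T. *)
Lemma curv_coef_adjoint Ga x i j :
  (forall k l, derivable_mx k (Ga^~ l) x) ->
  curv_coef (fun y k => - (Ga y k)^T) x i j = - (curv_coef Ga x i j)^T.
Proof.
move=> dG; have dGt k l := derivable_mx_tr (dG k l).
rewrite /curv_coef !partial_mxN // !partial_mx_tr.
rewrite !mulNmx !mulmxN !opprK -!trmx_mul.
by apply/matrixP => k l; rewrite !(addmxE, oppmxE) !mxE; ring.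
Qed.

(** A torsion-free Ga is symmetric in its two lower indices; so are its
derivatives and the products Ga_p Ga_q in the last two indices, and the cyclic
sum cancels in pairs. *)
Lemma curv_coef_bianchi Ga x i j k a : O x ->
  (forall y i j a, O y -> Ga y i a j = Ga y j a i) ->
  curv_coef Ga x i j a k + curv_coef Ga x j k a i + curv_coef Ga x k i a j = 0.
Proof.
move=> Ox torG.
have dG p q r : partial_mx p (fun y => Ga y q) x a r
              = partial_mx p (fun y => Ga y r) x a q.
  rewrite !partial_mx_entry; apply: near_eq_derive; near=> y.
  by apply: torG; near: y; exact: open_nbhs_nbhs.
have mG p q r : (Ga x p *m Ga x q) a r = (Ga x p *m Ga x r) a q.
  by rewrite mxE [RHS]mxE; apply: eq_bigr => b _; rewrite (torG x q r b).
rewrite /curv_coef !(addmxE, oppmxE).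
have := dG i k j; have := dG j k i; have := dG k j i.
have := mG i k j; have := mG j k i; have := mG k j i.
lra.
Unshelve. all: by end_near. Qed.

Definition nabla_coef Ga (T : 'cV[R]_m -> 'M[R]_m) x i : 'M[R]_m :=
  partial_mx i T x + Ga x i *m T x - T x *m Ga x i.

(** If the b-adjoint of T is s T, the same holds for the covariant derivative
of T, as soon as b is parallel: differentiate T^T b = s b T and eliminate d b.
*)
Lemma nabla_coef_adjoint Ga (b T : 'cV[R]_m -> 'M[R]_m) s x i : O x ->
  smooth_mx_on O b -> smooth_mx_on O T ->
  partial_mx i b x = (Ga x i)^T *m b x + b x *m Ga x i ->
  (forall y, O y -> (T y)^T *m b y = s *: (b y *m T y)) ->
  (nabla_coef Ga T x i)^T *m b x = s *: (b x *m nabla_coef Ga T x i).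
Proof.
move=> Ox sb sT Eb Tb.
have db k : derivable_mx k b x by exact: smooth_mx_derivable sb Ox.
have dT k : derivable_mx k T x by exact: smooth_mx_derivable sT Ox.
have dTt k := derivable_mx_tr (dT k).
have := partial_mx_local i oO Ox Tb.
rewrite partial_mxM // partial_mx_tr partial_mxZ; last exact: derivable_mxM.
rewrite partial_mxM // Eb /nabla_coef.
move: (Tb x Ox).
move: (partial_mx i T x) (T x) (b x) (Ga x i) => dt t bb ga Tbx H.
have H1 : ga^T *m (t^T *m bb) = s *: (ga^T *m (bb *m t)).
  by rewrite Tbx -scalemxAr.
have H2 : t^T *m bb *m ga = s *: (bb *m t *m ga) by rewrite Tbx -scalemxAl.
have -> : (dt + ga *m t - t *m ga)^T = dt^T + t^T *m ga^T - ga^T *m t^T.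
  by rewrite (raddfB (@trmx R m m)) (raddfD (@trmx R m m)) /= !trmx_mul.
apply/matrixP => k l; have /matrixP/(_ k l) {H} := H.
have /matrixP/(_ k l) {H1} := H1; have /matrixP/(_ k l) {H2} := H2.
rewrite !(mulmxDl, mulmxDr, mulNmx, mulmxN, mulmxA, scalerDr, scalerN,
  addmxE, oppmxE).
move=> H2 H1 H; lra.
Qed.

End Connection.

(** * Vanishing of curvature-like tensors *)

Section CurvatureLike.
Variables (R : realFieldType) (V : zmodType) (r : V -> V -> V -> V -> R).
Hypothesis r12 : forall x y z w, r y x z w = - r x y z w.
Hypothesis r34 : forall x y z w, r x y w z = - r x y z w.
Hypothesis bianchi : forall x y z w, r x y z w + r y z x w + r z x y w = 0.

(** The four Bianchi identities on the cyclic permutations of x, y, z, w,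
combined with the two skew symmetries. *)
Lemma curvature_pair_sym x y z w : r x y z w = r z w x y.
Proof.
have b1 := bianchi x y z w; have b2 := bianchi y z w x.
have b3 := bianchi z w x y; have b4 := bianchi w x y z.
have := r34 y z w x; have := r34 z w x y; have := r34 w x y z.
have := r34 x y z w; have := r12 w x z y; have := r12 x z y w.
have := r34 z x w y; have := r12 x z w y.
have := r12 y w z x; have := r12 w y x z; have := r34 y w x z.
have := r34 w x z y; have := r34 x w y z; have := r12 x w z y.
have := r12 w x y z; have := r34 y z x w; have := r34 x y w z.
have := r34 z y w x; have := r12 z w y x.
have := r34 w y x z.
lra.
Qed.

(** By pair symmetry J is symmetric on the first two slots as well. Let S = r
(J x) y z w and T = r x y (J z) w. The Bianchi identity for x, y, J z
expresses T as minus the sum of the two other cyclic permutations of S. The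
cyclic sum of T vanishes, by the Bianchi identity with J moved to w, hence so
does that of S, and T = S. *)
Lemma curvature_slot_shift (J : V -> V) :
  (forall x y z w, r x y (J z) w = r x y z (J w)) ->
  (forall x y z w, r (J x) y z w = r x (J y) z w) /\
  (forall x y z w, r (J x) y z w = r x y (J z) w).
Proof.
move=> J34.
have J12 x y z w : r (J x) y z w = r x (J y) z w.
  by rewrite curvature_pair_sym J34 [LHS]curvature_pair_sym.
split=> // x y z w.
have := bianchi x y z (J w); rewrite -!J34.
have := bianchi x y (J z) w; have := bianchi y z (J x) w.
have := bianchi z x (J y) w; rewrite !J12.
lra.
Qed.

(** Moving J and K through the third slot turns r (J x) (K y) into r x (K (J
y)), while moving J directly to the second slot gives r x (J (K y)) = - r x (K
(J y)). *)
Lemma anticommuting_curvature0 (J K : V -> V) :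
  (forall x y z w, r x (- y) z w = - r x y z w) ->
  (forall x, J (J x) = - x) -> (forall x, K (K x) = - x) ->
  (forall x, J (K x) = - K (J x)) ->
  (forall x y z w, r x y (J z) w = r x y z (J w)) ->
  (forall x y z w, r x y (K z) w = r x y z (K w)) ->
  forall x y z w, r x y z w = 0.
Proof.
move=> rN J_sqr KK JK /curvature_slot_shift[J12 J13].
move=> /curvature_slot_shift[K12 _].
have JK0 x y z w : r (J x) (K y) z w = 0.
  have E : r (J x) (K y) z w = r x (K (J y)) z w.
    by rewrite J13 -K12 -J13 J12 K12.
  have : r (J x) (K y) z w = - r x (K (J y)) z w by rewrite J12 JK rN.
  by rewrite E; lra.
have J0 x y z w : r (J x) y z w = 0.
  by have := JK0 x (K y) z w; rewrite KK rN; lra.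
move=> x y z w; have := J0 (J x) y z w.
by rewrite J_sqr r12 rN r12; lra.
Qed.

End CurvatureLike.

(** * Bilinear forms, linear forms and symmetric endomorphisms *)

Section Forms.
Variables (R : realType) (m : nat).
Local Notation V := 'cV[R]_m.
Implicit Types (b B C K S T : 'M[R]_m) (u v z : V).
Implicit Types (w : 'rV[R]_m) (i j k : 'I_m).

Lemma mulmx_sqrN1 T u : T *m T = (-1)%:M -> T *m (T *m u) = - u.
Proof. by move=> TT; rewrite mulmxA TT mul_scalar_mx scaleN1r. Qed.

Lemma form1N w u : form1 w (- u) = - form1 w u.
Proof. by rewrite /form1 mulmxN mxE. Qed.

Lemma form1_ebase w i : form1 w (ebase R i) = w 0 i.
Proof. by rewrite /form1 /ebase -colE mxE. Qed.

Lemma form1_scale0 w u B : B \in unitmx ->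
  form1 w u *: B = 0 -> form1 w u = 0.
Proof.
move=> BU wB; have /matrixP : form1 w u *: 1%:M = 0 :> 'M[R]_m.
  by rewrite -(mulmxV BU) scalemxAl wB mul0mx.
rewrite /form1; move: wB => _; case: m w u => [|k] w u wu.
  by rewrite mxE big_ord0.
by have := wu 0 0; rewrite !mxE eqxx mulr1.
Qed.

Lemma mulmx_inj_vec B C : (forall v, B *m v = C *m v :> V) -> B = C.
Proof.
move=> BC; apply/matrixP => i j.
by have /colP/(_ i) := BC (delta_mx j 0); rewrite -!colE !mxE.
Qed.

Lemma scalar0 (h : V -> R) : scalar h -> h 0 = 0.
Proof.
by move=> hl; have := hl (-1) 0 0; rewrite scaler0 addr0 mulN1r addNr.
Qed.

Lemma scalarN (h : V -> R) z : scalar h -> h (- z) = - h z.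
Proof.
move=> hl; have := hl (-1) z 0.
by rewrite scaleN1r addr0 (scalar0 hl) addr0 mulN1r.
Qed.

Lemma scalar_expand (h : V -> R) z : scalar h ->
  h z = \sum_k z k 0 * h (ebase R k).
Proof.
move=> hl; have zE : z = \sum_k z k 0 *: ebase R k.
  by rewrite {1}[z]matrix_sum_delta; apply: eq_bigr => k _; rewrite big_ord1.
rewrite {1}zE; elim/big_rec2: _ => [|k p q _ <-]; first exact: scalar0.
exact: hl.
Qed.

Lemma form2_mull b B u v : form2 b (B *m u) v = form2 (B^T *m b) u v.
Proof. by rewrite /form2 trmx_mul !mulmxA. Qed.

Lemma form2_mulr b B u v : form2 b u (B *m v) = form2 (b *m B) u v.
Proof. by rewrite /form2 !mulmxA. Qed.

Lemma form2_ebase b i j : form2 b (ebase R i) (ebase R j) = b i j.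
Proof. by rewrite /form2 /ebase trmx_delta -rowE -colE !mxE. Qed.

Lemma form2_inj b b' : (forall u v, form2 b u v = form2 b' u v) -> b = b'.
Proof. by move=> bb'; apply/matrixP => i j; rewrite -!form2_ebase. Qed.

Lemma form2_opp b u v : form2 (- b) u v = - form2 b u v.
Proof. by rewrite /form2 mulmxN mulNmx mxE. Qed.

Lemma form2_scale a b u v : form2 (a *: b) u v = a * form2 b u v.
Proof. by rewrite /form2 -scalemxAr -scalemxAl mxE. Qed.

Lemma form2_oppr b u v : form2 b u (- v) = - form2 b u v.
Proof. by rewrite /form2 mulmxN mxE. Qed.

Lemma form2_oppl b u v : form2 b (- u) v = - form2 b u v.
Proof. by rewrite /form2 linearN /= !mulNmx mxE. Qed.

Lemma form2_0l b v : form2 b 0 v = 0.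
Proof. by rewrite /form2 trmx0 !mul0mx mxE. Qed.

Lemma form2_addl b u v z : form2 b (u + v) z = form2 b u z + form2 b v z.
Proof. by rewrite /form2 linearD /= !mulmxDl mxE. Qed.

Lemma form2_sym b u v : b^T = b -> form2 b u v = form2 b v u.
Proof.
move=> bT.
rewrite /form2 -[in RHS](trmxK (v^T *m b *m u)) [RHS]mxE.
by rewrite !trmx_mul trmxK bT mulmxA.
Qed.

Lemma form2_nondeg b C : b \in unitmx ->
  (forall u v, form2 b (C *m u) v = 0) -> C = 0.
Proof.
move=> bU C0; have CTb : C^T *m b = 0.
  by apply: form2_inj => u v; rewrite -form2_mull C0 /form2 mulmx0 mul0mx mxE.
by rewrite -[C]trmxK -[C^T](mulmxK bU) CTb mul0mx trmx0.
Qed.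

(** If S is b-symmetric and K is b-skew, a b-symmetric combination s S + t K
has no skew part. *)
Lemma skew_part0 b S K (s t : R) :
  S^T *m b = b *m S -> K^T *m b = - (b *m K) ->
  (s *: S + t *: K)^T *m b = b *m (s *: S + t *: K) -> t *: (b *m K) = 0.
Proof.
move=> Sb Kb; rewrite linearD !linearZ /= mulmxDl mulmxDr.
rewrite -!scalemxAl -!scalemxAr Sb Kb => /addrI/eqP.
rewrite scalerN eq_sym -subr_eq0 opprK -mulr2n -scaler_nat scalerA.
by rewrite scaler_eq0 mulf_eq0 pnatr_eq0 /= -scaler_eq0 => /eqP.
Qed.

End Forms.

(** * The curvature operator at a point *)

Section CurvatureOperator.
Variables (R : realType) (m : nat).
Implicit Types (u v w : 'cV[R]_m) (i j k : 'I_m).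
Variable K : 'I_m -> 'I_m -> 'M[R]_m.

Definition curv_op u v : 'M[R]_m :=
  \sum_i \sum_j (u i 0 * v j 0) *: K i j.

Lemma curv_opC : (forall i j, K j i = - K i j) ->
  forall u v, curv_op v u = - curv_op u v.
Proof.
move=> KN u v; rewrite /curv_op exchange_big -sumrN; apply: eq_bigr => i _.
rewrite -sumrN; apply: eq_bigr => j _; rewrite KN scalerN; congr (- (_ *: _)).
exact: mulrC.
Qed.

Lemma curv_opNr u v : curv_op u (- v) = - curv_op u v.
Proof.
rewrite /curv_op -sumrN; apply: eq_bigr => i _; rewrite -sumrN.
by apply: eq_bigr => j _; rewrite mxE mulrN scaleNr.
Qed.

Lemma curv_op_bianchi :
  (forall i j k a, K i j a k + K j k a i + K k i a j = 0) ->
  forall u v w, curv_op u v *m w + curv_op v w *m u + curv_op w u *m v = 0.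
Proof.
move=> KB u v w.
have E u' v' w' a : (curv_op u' v' *m w') a 0 =
    \sum_i \sum_j \sum_k u' i 0 * v' j 0 * w' k 0 * K i j a k.
  rewrite mxE; under eq_bigr => k _.
    rewrite summxE big_distrl /=; under eq_bigr => i _.
      rewrite summxE big_distrl /=; under eq_bigr => j _.
        rewrite mxE mulrAC.
        over.
      over.
    over.
  rewrite exchange_big; apply: eq_bigr => i _ /=.
  by rewrite exchange_big.
have rot (F : 'I_m -> 'I_m -> 'I_m -> R) :
    \sum_i \sum_j \sum_k F i j k = \sum_k \sum_i \sum_j F i j k.
  rewrite exchange_big; under eq_bigr do rewrite exchange_big.
  rewrite exchange_big; apply: eq_bigr => k _; exact: exchange_big.
apply/colP => a; rewrite addmxE addmxE [RHS]mxE !E.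
rewrite [X in _ + X + _]rot [X in _ + X]rot [X in _ + X]rot -!big_split /=.
apply: big1 => i _; rewrite -!big_split /=; apply: big1 => j _.
rewrite -!big_split /=; apply: big1 => k _ /=.
rewrite -[RHS](mulr0 (u i 0 * v j 0 * w k 0)) -(KB i j k a).
ring.
Qed.

(** The tensor r x y z w = b (R(x,y) z, w) satisfies the hypotheses of
[anticommuting_curvature0]: J2 and J3 commute with R and are b-symmetric, so
they pass from z to w. *)
Lemma norden_curv_op0 (b J2 J3 : 'M[R]_m) :
  b \in unitmx -> b^T = b ->
  (forall i j, K j i = - K i j) ->
  (forall i j k a, K i j a k + K j k a i + K k i a j = 0) ->
  (forall i j, b *m K i j = - (K i j)^T *m b) ->
  (forall i j, J2 *m K i j = K i j *m J2) ->
  (forall i j, J3 *m K i j = K i j *m J3) ->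
  J2^T *m b = b *m J2 -> J3^T *m b = b *m J3 ->
  J2 *m J2 = (-1)%:M -> J3 *m J3 = (-1)%:M -> J2 *m J3 = - (J3 *m J2) ->
  forall u v, curv_op u v = 0.
Proof.
move=> bU bT KN KB Kb K2 K3 b2 b3 J22 J33 J2_J3.
pose r x y z w := form2 b (curv_op x y *m z) w.
have op_com T : (forall i j, T *m K i j = K i j *m T) ->
    forall u v, T *m curv_op u v = curv_op u v *m T.
  move=> TK u v; rewrite /curv_op mulmx_sumr mulmx_suml.
  apply: eq_bigr => i _; rewrite mulmx_sumr mulmx_suml.
  by apply: eq_bigr => j _; rewrite -scalemxAr -scalemxAl TK.
have op_skew u v : b *m curv_op u v = - (curv_op u v)^T *m b.
  rewrite /curv_op mulmx_sumr linear_sum -sumrN mulmx_suml.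
  apply: eq_bigr => i _; rewrite mulmx_sumr linear_sum -sumrN mulmx_suml.
  apply: eq_bigr => j _; rewrite -scalemxAr Kb linearZ /= -scalerN.
  by rewrite -scalemxAl.
have move_J T : (forall i j, T *m K i j = K i j *m T) -> T^T *m b = b *m T ->
    forall x y z w, r x y (T *m z) w = r x y z (T *m w).
  move=> TK Tb x y z w.
  by rewrite /r mulmxA -op_com // -mulmxA form2_mull Tb form2_mulr.
have r0 : forall x y z w, r x y z w = 0.
  apply: (@anticommuting_curvature0 _ _ r _ _ _ (mulmx J2) (mulmx J3)).
  - by move=> x y z w; rewrite /r curv_opC // mulNmx form2_oppl.
  - move=> x y z w; rewrite /r form2_mull.
    have -> : (curv_op x y)^T *m b = - (b *m curv_op x y).
      by rewrite op_skew mulNmx opprK.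
    by rewrite form2_opp -form2_mulr (form2_sym _ _ bT).
  - by move=> x y z w; rewrite /r -!form2_addl curv_op_bianchi // form2_0l.
  - by move=> x y z w; rewrite /r curv_opNr mulNmx form2_oppl.
  - by move=> x; exact: mulmx_sqrN1.
  - by move=> x; exact: mulmx_sqrN1.
  - by move=> x; rewrite !mulmxA J2_J3 mulNmx.
  - exact: move_J.
  - exact: move_J.
by move=> u v; apply: (form2_nondeg bU) => z w; exact: r0.
Qed.

End CurvatureOperator.

(** * The classes W_1, W_2, W_3 *)

Section Classes.
Variables (R : realType) (n : nat).
Local Notation m := (4 * n)%N.
Local Notation V := 'cV[R]_m.
Variables (b E : 'M[R]_m).
Hypotheses (bU : b \in unitmx) (Eb : E^T *m b = b *m E)
  (EE : E *m E = (-1)%:M).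
Implicit Types (F P : V -> V -> V -> R) (S : {set 'I_3}).

Lemma theta_opp F z : trilinear F -> theta b F (- z) = - theta b F z.
Proof.
move=> triF; rewrite /theta -sumrN; apply: eq_bigr => i _.
rewrite -sumrN; apply: eq_bigr => j _; rewrite -mulrN; congr (_ * _).
by case: triF => _ _ /(_ (ebase R i) (ebase R j)); exact: scalarN.
Qed.

Lemma theta_sum (P : 'I_3 -> V -> V -> V -> R) S F z :
  (forall x y z, F x y z = \sum_(i in S) P i x y z) ->
  theta b F z = \sum_(i in S) theta b (P i) z.
Proof.
move=> FP; rewrite /theta [RHS]exchange_big; apply: eq_bigr => i _.
rewrite [RHS]exchange_big; apply: eq_bigr => j _.
by rewrite FP mulr_sumr.
Qed.

Hypothesis bT : b^T = b.

(** In the defining formula of W_1, each of the products of g with theta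
occurs in the cyclic sum twice with opposite signs, by the symmetry of g and
of g(., E .). *)
Lemma W1_cyclic F : Fspace E F -> W1 b E F ->
  forall x y z, F x y (E *m z) + F y z (E *m x) + F z x (E *m y) = 0.
Proof.
move=> [triF _ _] FW x y z.
have gE u v : form2 b u (E *m v) = form2 b v (E *m u).
  by rewrite form2_sym // form2_mull Eb form2_mulr.
have gC u v : form2 b u v = form2 b v u by exact: form2_sym.
rewrite !FW !(mulmx_sqrN1 _ EE) !theta_opp // !form2_oppr.
rewrite (gC y x) (gC z x) (gC z y) (gE y x) (gE z x) (gE z y).
ring.
Qed.

(** A b-symmetric E with E^2 = -1 is an anti-isometry of b; this is the same
fact for the inverse form on covectors. *)
Lemma anti_isometry_dual : E *m invmx b *m E^T = - invmx b.
Proof.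
have EEb : E^T *m b *m E = - b.
  by rewrite Eb -mulmxA EE mul_mx_scalar scaleN1r.
apply: (can_inj (mulmxK bU)).
rewrite mulNmx mulVmx // -!mulmxA Eb (mulKmx bU) EE.
exact: raddfN.
Qed.

(** Changing the basis by E changes the sign of the inverse of b and does not
change f, so the trace of f equals its opposite. *)
Lemma contract_anti_isometry0 (f : V -> V -> R) :
  (forall y, scalar (f^~ y)) -> (forall x, scalar (f x)) ->
  (forall x y, f (E *m x) (E *m y) = f x y) ->
  \sum_i \sum_j invmx b i j * f (ebase R i) (ebase R j) = 0.
Proof.
move=> fl fr fE.
pose Phi : 'M[R]_m := \matrix_(i, j) f (ebase R i) (ebase R j).
have trE (C : 'M[R]_m) :
    \sum_i \sum_j C i j * f (ebase R i) (ebase R j) = \tr (C *m Phi^T).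
  by apply: eq_bigr => i _; rewrite mxE; apply: eq_bigr => j _; rewrite !mxE.
have PhiE : Phi = E^T *m Phi *m E.
  have Ecol k i : (E *m ebase R i) k 0 = E k i by rewrite /ebase -colE mxE.
  apply/matrixP => i j; rewrite mxE -fE (scalar_expand _ (fr _)) [RHS]mxE.
  apply: eq_bigr => l _; rewrite Ecol [RHS]mulrC; congr (_ * _).
  rewrite mxE; apply: etrans (scalar_expand _ (fl _)) _.
  by apply: eq_bigr => k _; rewrite Ecol !mxE.
have : \tr (invmx b *m Phi^T) = - \tr (invmx b *m Phi^T).
  have trI : \tr (invmx b *m Phi^T) = \tr (E *m invmx b *m E^T *m Phi^T).
    by rewrite -2!mulmxA [RHS]mxtrace_mulC {1}PhiE !trmx_mul (trmxK E) !mulmxA.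
  by rewrite {1}trI anti_isometry_dual mulNmx linearN.
by rewrite trE; lra.
Qed.

(** Contracting the cyclic sum over the first two arguments gives 2 theta plus
the trace of F(z, ., .), and the latter vanishes by [contract_anti_isometry0].
*)
Lemma W3_theta F : Fspace E F -> W3 F -> forall z, theta b F z = 0.
Proof.
move=> [[F1 F2 F3] Fs FE] FW z.
have biT : (invmx b)^T = invmx b by rewrite trmx_inv bT.
have C : \sum_i \sum_j invmx b i j * F z (ebase R i) (ebase R j) = 0.
  apply: contract_anti_isometry0 => [y|x|x y]; [exact: F2|exact: F3|].
  by rewrite -FE.
have S : theta b F z = \sum_i \sum_j invmx b i j * F (ebase R j) z (ebase R i).
  rewrite /theta exchange_big; apply: eq_bigr => i _; apply: eq_bigr => j _.
  by rewrite -[in LHS]biT mxE Fs.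
have : theta b F z + theta b F z
    + \sum_i \sum_j invmx b i j * F z (ebase R i) (ebase R j) = 0.
  rewrite {2}S /theta -!big_split; apply: big1 => i _ /=.
  rewrite -!big_split; apply: big1 => j _ /=.
  by rewrite -!mulrDr FW mulr0.
by rewrite C; lra.
Qed.

Lemma class12_cyclic S F : S \subset [set ix1; ix2]%SET -> in_Wsum b E S F ->
  forall x y z, F x y (E *m z) + F y z (E *m x) + F z x (E *m y) = 0.
Proof.
move=> /fintype.subsetP S12 [P [PS FP]] x y z; rewrite !FP -!big_split.
apply: big1 => i iS /=; move: (PS i iS).
have /[!inE] /orP[/eqP->|/eqP->] := S12 i iS; rewrite /Wi /= => -[].
  by move=> PE PW; exact: W1_cyclic PE PW x y z.
by move=> _ [].
Qed.

Lemma class23_theta S F : S \subset [set ix2; ix3]%SET -> in_Wsum b E S F ->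
  forall z, theta b F z = 0.
Proof.
move=> /fintype.subsetP S23 [P [PS FP]] z; rewrite (theta_sum _ FP).
apply: big1 => i iS; move: (PS i iS).
have /[!inE] /orP[/eqP->|/eqP->] := S23 i iS; rewrite /Wi /= => -[].
  by move=> _ [].
by move=> PE PW; exact: W3_theta PE PW z.
Qed.

(** With respect to b the form c is represented by the endomorphism b^-1 c;
contracting the two first arguments of w (x) c composes w with it. *)
Lemma theta_prod (w : 'rV[R]_m) (c : 'M[R]_m) F :
  (forall x y z, F x y z = form1 w x * form2 c y z) ->
  forall z, theta b F z = form1 w (invmx b *m c *m z).
Proof.
move=> FE z; rewrite /form1 !mulmxA -[w *m _ *m c *m z]mulmxA /theta.
rewrite exchange_big mxE; apply: eq_bigr => j _ /=.
rewrite mxE mulr_suml; apply: eq_bigr => i _.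
rewrite FE mulrCA mulrA; congr (_ * _ * _).
  exact: form1_ebase.
by rewrite /form2 /ebase trmx_delta -mulmxA -rowE mxE.
Qed.

End Classes.

(** * Wedge product with a nondegenerate 2-form *)

Section Wedge.
Variables (R : realType) (m : nat).

(** The hypothesis is w /\ c = 0. Contracting two of the indices with the
inverse of c gives m w from the first term and - w from each of the others, so
(m - 2) w = 0. In dimension 2 every 3-form vanishes and the conclusion fails.
*)
Lemma wedge_nondeg0 (w : 'rV[R]_m) (c : 'M[R]_m) :
  m != 2 -> c \in unitmx -> c^T = - c ->
  (forall x y z, form1 w x * form2 c y z + form1 w y * form2 c z x
                 + form1 w z * form2 c x y = 0) ->
  w = 0.
Proof.
move=> m2 cU cT wc; apply/rowP => i; rewrite [RHS]mxE.
have wcE j k : w 0 i * c j k + w 0 j * c k i + w 0 k * c i j = 0.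
  have := wc (ebase R i) (ebase R j) (ebase R k).
  by rewrite !form1_ebase !form2_ebase.
have cE j k : c j k = - c k j.
  by have := congr1 (fun A : 'M[R]_m => A k j) cT; rewrite mxE oppmxE.
have T1 : \sum_j \sum_k invmx c k j * (w 0 i * c j k) = m%:R * w 0 i.
  have : \tr (invmx c *m c) = m%:R by rewrite mulVmx // mxtrace1.
  move=> <-; rewrite mulr_suml exchange_big; apply: eq_bigr => k _.
  rewrite mxE mulr_suml; apply: eq_bigr => j _; ring.
have T2 : \sum_j \sum_k invmx c k j * (w 0 j * c k i) = - w 0 i.
  have : w *m (c *m invmx c)^T = w by rewrite mulmxV // trmx1 mulmx1.
  move/rowP/(_ i) => <-; rewrite mxE -sumrN; apply: eq_bigr => j _.
  rewrite !mxE mulr_sumr -sumrN; apply: eq_bigr => k _; rewrite (cE k i).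
  ring.
have T3 : \sum_j \sum_k invmx c k j * (w 0 k * c i j) = - w 0 i.
  have : w *m (invmx c *m c) = w by rewrite mulVmx // mulmx1.
  move/rowP/(_ i) => <-; rewrite mxE exchange_big -sumrN.
  apply: eq_bigr => k _ /=; rewrite mxE mulr_sumr -sumrN.
  apply: eq_bigr => j _; rewrite (cE i j); ring.
have : \sum_j \sum_k invmx c k j *
    (w 0 i * c j k + w 0 j * c k i + w 0 k * c i j) = 0.
  by apply: big1 => j _; apply: big1 => k _; rewrite wcE mulr0.
under eq_bigr do under eq_bigr do rewrite !mulrDr.
under eq_bigr do rewrite !big_split.
rewrite !big_split /= T1 T2 T3 => H.
have /eqP : (m%:R - 2) * w 0 i = 0 by rewrite -[RHS]H; ring.
by rewrite mulf_eq0 subr_eq0 (eqr_nat R m 2) (negPf m2) => /eqP.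
Qed.

End Wedge.

(** * Quaternionic Kaehler NH-manifolds *)

Section QuaternionicKaehler.
Variables (R : realType) (n : nat) (M : topologicalType).
Local Notation m := (4 * n)%N.
Variables (A : set (chart R M m)) (J : 'I_3 -> tfield R M m m m).
Variables (g : tfield R M m m m) (gs : 'I_3 -> tfield R M m m m).
Variable Gam : connection_coef R M m.
Hypotheses (HJ : almost_hypercomplex A J) (Hg : nh_metric A J g gs)
  (HGam : levi_civita A g Gam).

Lemma coords_open (c : chart R M m) : open (coords c setT).
Proof. by rewrite /coords setIT; exact: cimg_open. Qed.

Lemma neutral_unit (b : 'M[R]_m) : neutral b -> b \in unitmx.
Proof.
case=> P _ Pb.
have : P^T *m b *m P \in unitmx.
  rewrite Pb unitmxE det_diag unitfE; apply/prodf_neq0 => i _; rewrite mxE.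
  by case: ifP => _; rewrite ?oppr_eq0 oner_eq0.
by rewrite !unitmx_mul => /andP[/andP[_ ->]].
Qed.

Section AtPoint.
Variables (c : chart R M m) (x : 'cV[R]_m).
Hypotheses (Ac : A c) (cx : coords c setT x).

Lemma metric_unit : g c x \in unitmx.
Proof. by case: Hg => _ _ /(_ c x Ac cx) /neutral_unit. Qed.

Lemma metric_sym : (g c x)^T = g c x.
Proof. by case: Hg => _ /(_ c x Ac cx). Qed.

Lemma J_sqr a : J a c x *m J a c x = (-1)%:M.
Proof. by case: HJ => _ H _ _; exact: H. Qed.

Lemma J_unit a : J a c x \in unitmx.
Proof.
have : J a c x *m - J a c x = 1%:M.
  by rewrite mulmxN J_sqr; apply/esym; rewrite [X in - X]raddfN opprK.
by case/mulmx1_unit.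
Qed.

(** The compatibility g = eps_a J_a^T g J_a combined with J_a^2 = -1. *)
Lemma J_adjoint a : (J a c x)^T *m g c x = - eps R a *: (g c x *m J a c x).
Proof.
have gJ : g c x = eps R a *: ((J a c x)^T *m g c x *m J a c x).
  apply: form2_inj => u v; case: Hg => _ _ _ /(_ a c x u v Ac cx) -> _.
  by rewrite form2_mull form2_mulr form2_scale.
rewrite {2}gJ -scalemxAl -[_ *m J a c x *m _]mulmxA J_sqr mul_mx_scalar.
rewrite scaleN1r scalerN -scaleNr scalerA -[LHS]scale1r; congr (_ *: _).
by rewrite /eps; case: ifP => _; ring.
Qed.

Lemma J2_adjoint : (J ix2 c x)^T *m g c x = g c x *m J ix2 c x.
Proof. by rewrite J_adjoint /eps /= opprK scale1r. Qed.

Lemma J3_adjoint : (J ix3 c x)^T *m g c x = g c x *m J ix3 c x.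
Proof. by rewrite J_adjoint /eps /= opprK scale1r. Qed.

Lemma J2_J3 : J ix2 c x *m J ix3 c x = - (J ix3 c x *m J ix2 c x).
Proof.
case: HJ => _ _ H1 H2; have := H1 ix1 c x Ac cx; rewrite (H2 ix1 c x Ac cx).
have -> : ix1 + 1 = ix2 by exact/val_inj.
by have -> : ix2 + 1 = ix3 by exact/val_inj.
Qed.

End AtPoint.

Lemma J_adjoint_on a c y : A c -> coords c setT y ->
  (J a c y)^T *m g c y = - eps R a *: (g c y *m J a c y).
Proof. by move=> Ac cy; exact: J_adjoint. Qed.

Lemma J_smooth a c : A c -> smooth_mx_on (coords c setT) (J a c).
Proof. by case: HJ => /(_ a)[H _] _ _ _; exact: H. Qed.

Lemma metric_smooth c : A c -> smooth_mx_on (coords c setT) (g c).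
Proof. by case: Hg => -[H _] _ _ _ _; exact: H. Qed.

Lemma Gam_smooth c i : A c -> smooth_mx_on (coords c setT) (fun y => Gam c y i).
Proof. by case: HGam => -[H _] _ _ Ac; exact: H. Qed.

Lemma nabla_endoE a c x u :
  nabla_endo Gam (J a) c x u = \sum_i u i 0 *: nabla_coef (Gam c) (J a c) x i.
Proof. by []. Qed.

Lemma nabla_adjoint a c x u : A c -> coords c setT x ->
  (nabla_endo Gam (J a) c x u)^T *m g c x
    = - eps R a *: (g c x *m nabla_endo Gam (J a) c x u).
Proof.
move=> Ac cx; rewrite nabla_endoE linear_sum mulmx_suml mulmx_sumr scaler_sumr.
apply: eq_bigr => i _; rewrite linearZ /= -scalemxAl -scalemxAr.
rewrite (@nabla_coef_adjoint _ _ _ (@coords_open c) _ _ _ (- eps R a)) //.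
- by rewrite !scalerA mulrC.
- exact: metric_smooth.
- exact: J_smooth.
- by case: HGam => _ _; apply.
- by move=> y; exact: J_adjoint_on.
Qed.

(** Since g and the J_a are parallel, their integrability conditions make the
curvature g-skew and commuting with J_2, J_3; torsion-freeness gives the
Bianchi identity, and [norden_curv_op0] applies at each point. *)
Lemma hyper_kahler_flat : hyper_kahler A J Gam -> flat A Gam.
Proof.
move=> HK c x u v Ac cx.
have oO := @coords_open c.
have dG k l : derivable_mx k (fun y => Gam c y l) x.
  exact: smooth_mx_derivable (Gam_smooth l Ac) cx.
have JK a i j : J a c x *m curv_coef (Gam c) x i j
              = curv_coef (Gam c) x i j *m J a c x.
  apply: (parallel_intertwines_curv oO i j cx (J_smooth a Ac) dG dG) => y k cy.
  have := HK a c y (ebase R k) Ac cy; rewrite nabla_endoE (bigD1 k) //=.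
  rewrite big1 => [|l lk]; last by rewrite mxE (negPf lk) scale0r.
  rewrite mxE !eqxx scale1r addr0 /nabla_coef => /eqP.
  by rewrite subr_eq0 => /eqP/esym ->; rewrite addrK.
apply: (@norden_curv_op0 _ _ (curv_coef (Gam c) x) (g c x) (J ix2 c x)
  (J ix3 c x) (metric_unit Ac cx) (metric_sym Ac cx)).
- by move=> i j; exact: curv_coefN.
- move=> i j k a; apply: (curv_coef_bianchi oO _ _ _ _ cx) => y p q r cy.
  by case: HGam => _ H _; exact: H.
- move=> i j; rewrite -(curv_coef_adjoint _ _ dG).
  apply: (parallel_intertwines_curv oO i j cx (metric_smooth Ac) _ dG).
    by move=> k l; apply: derivable_mxN; exact: derivable_mx_tr (dG k l).
  move=> y k cy; case: HGam => _ _ /(_ c y k Ac cy) ->.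
  by rewrite mulNmx opprK addrC.
- exact: JK.
- exact: JK.
- exact: J2_adjoint.
- exact: J3_adjoint.
- exact: J_sqr.
- exact: J_sqr.
- exact: J2_J3.
Qed.

Section LocalForms.
Variables (W : set M) (om : 'I_3 -> tfield R M m 1 m).
Hypothesis Hom : qk_forms A J Gam W om.
Variables (c : chart R M m) (x : 'cV[R]_m).
Hypotheses (Ac : A c) (cW : coords c W x).

Lemma coords_sub : coords c setT x.
Proof. by case: cW => p [cp _] <-; exists p. Qed.
Let cx := coords_sub.

Lemma nabla_qk a u : nabla_endo Gam (J a) c x u =
  form1 (om (a + 1 + 1) c x) u *: J (a + 1) c x
  - form1 (om (a + 1) c x) u *: J (a + 1 + 1) c x.
Proof.
apply: mulmx_inj_vec => v; case: Hom => _ /(_ a c x u v Ac cW) ->.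
by rewrite mulmxBl !scalemxAl.
Qed.

Lemma nabla2 u : nabla_endo Gam (J ix2) c x u =
  form1 (om ix1 c x) u *: J ix3 c x - form1 (om ix3 c x) u *: J ix1 c x.
Proof.
rewrite nabla_qk; have -> : ix2 + 1 = ix3 by exact/val_inj.
by have -> : ix3 + 1 = ix1 by exact/val_inj.
Qed.

Lemma nabla3 u : nabla_endo Gam (J ix3) c x u =
  form1 (om ix2 c x) u *: J ix1 c x - form1 (om ix1 c x) u *: J ix2 c x.
Proof.
rewrite nabla_qk; have -> : ix3 + 1 = ix1 by exact/val_inj.
by have -> : ix1 + 1 = ix2 by exact/val_inj.
Qed.

Lemma nabla1 u : nabla_endo Gam (J ix1) c x u =
  form1 (om ix3 c x) u *: J ix2 c x - form1 (om ix2 c x) u *: J ix3 c x.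
Proof.
rewrite nabla_qk; have -> : ix1 + 1 = ix2 by exact/val_inj.
by have -> : ix2 + 1 = ix3 by exact/val_inj.
Qed.

Lemma gJ1_unit : g c x *m J ix1 c x \in unitmx.
Proof. by rewrite unitmx_mul metric_unit // J_unit. Qed.

Lemma J1_adjoint : (J ix1 c x)^T *m g c x = - (g c x *m J ix1 c x).
Proof. by rewrite J_adjoint // /eps /= scaleN1r. Qed.

(** nabla J_2 is g-symmetric as J_2 is, and so is J_3; the g-skew term om_3
J_1 of nabla J_2 must vanish. *)
Lemma om3_0 u : form1 (om ix3 c x) u = 0.
Proof.
apply: (form1_scale0 gJ1_unit); rewrite -[LHS]opprK -scaleNr.
have := nabla_adjoint ix2 u Ac cx; rewrite /eps /= opprK scale1r nabla2.
rewrite -scaleNr => /(skew_part0 (J3_adjoint Ac cx) J1_adjoint) ->.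
exact: oppr0.
Qed.

(** As for om_3, with the g-skew term om_2 J_1 of nabla J_3. *)
Lemma om2_0 u : form1 (om ix2 c x) u = 0.
Proof.
apply: (form1_scale0 gJ1_unit).
have := nabla_adjoint ix3 u Ac cx; rewrite /eps /= opprK scale1r nabla3 addrC.
by rewrite -scaleNr => /(skew_part0 (J2_adjoint Ac cx) J1_adjoint).
Qed.

Lemma nabla1_0 u : nabla_endo Gam (J ix1) c x u = 0.
Proof. by rewrite nabla1 om2_0 om3_0 !scale0r subr0. Qed.

Lemma nabla2E u :
  nabla_endo Gam (J ix2) c x u = form1 (om ix1 c x) u *: J ix3 c x.
Proof. by rewrite nabla2 om3_0 scale0r subr0. Qed.

Lemma nabla3E u :
  nabla_endo Gam (J ix3) c x u = - (form1 (om ix1 c x) u *: J ix2 c x).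
Proof. by rewrite nabla3 om2_0 scale0r sub0r. Qed.

Lemma Ften2E u v w : Ften J g Gam ix2 c x u v w =
  form1 (om ix1 c x) u * form2 (g c x *m J ix3 c x) v w.
Proof.
by rewrite /Ften nabla2E form2_mull linearZ /= -scalemxAl J3_adjoint //
  form2_scale.
Qed.

Lemma Ften3E u v w : Ften J g Gam ix3 c x u v w =
  form1 (om ix1 c x) u * form2 (- (g c x *m J ix2 c x)) v w.
Proof.
rewrite /Ften nabla3E form2_mull linearN linearZ /= mulNmx -scalemxAl.
by rewrite J2_adjoint // !form2_opp form2_scale mulrN.
Qed.

Lemma theta2E z :
  thetaJ J g Gam ix2 c x z = form1 (om ix1 c x) (J ix3 c x *m z).
Proof.
by rewrite /thetaJ (theta_prod _ Ften2E) (mulKmx (metric_unit Ac cx)).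
Qed.

Lemma theta3E z :
  thetaJ J g Gam ix3 c x z = - form1 (om ix1 c x) (J ix2 c x *m z).
Proof.
rewrite /thetaJ (theta_prod _ Ften3E) mulmxN (mulKmx (metric_unit Ac cx)).
by rewrite /form1 mulNmx mulmxN mxE.
Qed.

Lemma om1_theta2 u :
  form1 (om ix1 c x) u = - thetaJ J g Gam ix2 c x (J ix3 c x *m u).
Proof. by rewrite theta2E mulmx_sqrN1 ?J_sqr // form1N opprK. Qed.

Lemma om1_theta3 u :
  form1 (om ix1 c x) u = thetaJ J g Gam ix3 c x (J ix2 c x *m u).
Proof. by rewrite theta3E mulmx_sqrN1 ?J_sqr // form1N opprK. Qed.

(** The nondegenerate 2-form of the wedge argument is g(J_3 ., J_2 .), which
equals - g(., J_1 .) because J_3 J_2 = - J_1. *)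
Lemma om1_0_class12 (S : {set 'I_3}) : S \subset [set ix1; ix2]%SET ->
  in_Wsum (g c x) (J ix2 c x) S (Ften J g Gam ix2 c x) ->
  om ix1 c x = 0.
Proof.
move=> S12 FS.
have J2b := J2_adjoint Ac cx.
have cyc := class12_cyclic J2b (J_sqr Ac cx ix2) (metric_sym Ac cx) S12 FS.
apply: (@wedge_nondeg0 _ _ _ (g c x *m J ix3 c x *m J ix2 c x)).
- by apply/eqP => /(congr1 (dvdn 4)); rewrite dvdn_mulr.
- by rewrite !unitmx_mul metric_unit // !J_unit.
- rewrite !trmx_mul metric_sym // J3_adjoint // mulmxA J2b.
  by rewrite -!mulmxA J2_J3 // mulmxN.
- move=> y z w; rewrite -[RHS](cyc y z w) !Ften2E.
  by rewrite !(form2_mulr (g c x *m J ix3 c x)).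
Qed.

Lemma om1_0_class23 (S : {set 'I_3}) : S \subset [set ix2; ix3]%SET ->
  in_Wsum (g c x) (J ix2 c x) S (Ften J g Gam ix2 c x) ->
  om ix1 c x = 0.
Proof.
move=> S23 FS; apply/rowP => i; rewrite [RHS]mxE.
have := om1_theta2 (ebase R i); rewrite form1_ebase => ->.
rewrite /thetaJ (class23_theta (metric_unit Ac cx) (J2_adjoint Ac cx)
  (J_sqr Ac cx ix2) (metric_sym Ac cx) S23 FS).
exact: oppr0.
Qed.

Lemma nabla_om1_0 : om ix1 c x = 0 ->
  forall a u, nabla_endo Gam (J a) c x u = 0.
Proof.
move=> w0 a u; have w0u : form1 (om ix1 c x) u = 0.
  by rewrite w0 /form1 mul0mx mxE.
have : a \in [:: ix1; ix2; ix3] by case: a => -[|[|[|]]].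
rewrite !inE => /or3P[] /eqP ->; first exact: nabla1_0.
  by rewrite nabla2E w0u scale0r.
by rewrite nabla3E w0u scale0r oppr0.
Qed.

End LocalForms.

Hypothesis HQ : quaternionic_kahler A J Gam.

Lemma class_hyper_kahler (S : {set 'I_3}) :
  S \subset [set ix1; ix2]%SET \/ S \subset [set ix2; ix3]%SET ->
  in_class A J g Gam ix2 S -> hyper_kahler A J Gam.
Proof.
move=> SS HS a c x u Ac cx; case: (cx) => p [cp _] px.
have [W [om [_ Wp Hom]]] := HQ p.
have cW : coords c W x by exists p.
apply: (nabla_om1_0 Hom Ac cW).
case: SS => SS; first exact: om1_0_class12 Hom _ _ Ac cW _ SS (HS c x Ac cx).
exact: om1_0_class23 Hom _ _ Ac cW _ SS (HS c x Ac cx).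
Qed.

End QuaternionicKaehler.

Theorem mainTheorem2 (R : realType) (n : nat) (M : topologicalType)
    (A : set (chart R M (4 * n)))
    (J : 'I_3 -> tfield R M (4 * n) (4 * n) (4 * n))
    (g : tfield R M (4 * n) (4 * n) (4 * n))
    (gs : 'I_3 -> tfield R M (4 * n) (4 * n) (4 * n))
    (Gam : connection_coef R M (4 * n)) :
  smooth_manifold A ->
  almost_hypercomplex A J ->
  nh_metric A J g gs ->
  levi_civita A g Gam ->
  quaternionic_kahler A J Gam ->
  [/\ forall S : {set 'I_3},
        S \in [:: [set ix1; ix2]%SET; finset.set0; [set ix1]%SET; [set ix2]%SET;
                  [set ix2; ix3]%SET; [set ix3]%SET] ->
        in_class23 A J g Gam S ->
        flat A Gam /\ hyper_kahler A J Gam,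
      forall S : {set 'I_3},
        S != finset.setT ->
        in_class23 A J g Gam S ->
        ~ (flat A Gam /\ hyper_kahler A J Gam) ->
        S = [set ix1; ix3]%SET &
      in_class23 A J g Gam [set ix1; ix3]%SET ->
      forall (W : set M) (om : 'I_3 -> tfield R M (4 * n) 1 (4 * n)),
        open W -> qk_forms A J Gam W om ->
        forall (c : chart R M (4 * n)) (x u v : 'cV[R]_(4 * n)),
          A c -> coords c W x ->
          [/\ nabla_endo Gam (J ix1) c x u *m v = 0,
              nabla_endo Gam (J ix2) c x u *m v
                = form1 (om ix1 c x) u *: (J ix3 c x *m v),
              nabla_endo Gam (J ix3) c x u *m v
                = - (form1 (om ix1 c x) u *: (J ix2 c x *m v)),
              form1 (om ix1 c x) u
                = - thetaJ J g Gam ix2 c x (J ix3 c x *m u) &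
              form1 (om ix1 c x) u
                = thetaJ J g Gam ix3 c x (J ix2 c x *m u)]].
Proof.
move=> _ HJ Hg HGam HQ.
(* Each S in the statement avoids W_3 or avoids W_1. *)
have flat_hk (S : {set 'I_3}) :
    S \subset [set ix1; ix2]%SET \/ S \subset [set ix2; ix3]%SET ->
    in_class23 A J g Gam S -> flat A Gam /\ hyper_kahler A J Gam.
  move=> SS [HS _]; have hk := class_hyper_kahler HJ Hg HGam HQ SS HS.
  by split=> //; exact: hyper_kahler_flat HJ Hg HGam hk.
split.
- move=> S Sin; apply: flat_hk; move: Sin; rewrite !inE.
  case/or4P => [/eqP->|/eqP->|/eqP->|/or3P[]/eqP->];
    [left|left|left|left|right|right];
    by rewrite ?fintype.subxx ?finset.sub0set ?finset.sub1set ?inE ?eqxx ?orbT.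
- move=> S ST HS nhk.
  (* S meets both W_3 and W_1, and lacks W_2 since it is proper. *)
  have N12 : ~~ (S \subset [set ix1; ix2]%SET).
    by apply/negP => SS; apply: nhk; apply: flat_hk HS; left.
  have N23 : ~~ (S \subset [set ix2; ix3]%SET).
    by apply/negP => SS; apply: nhk; apply: flat_hk HS; right.
  have I3 (a : 'I_3) : [|| a == ix1, a == ix2 | a == ix3].
    by case: a => -[|[|[|]]].
  have S3 : ix3 \in S.
    move/fintype.subsetPn : N12 => [a aS]; rewrite !inE negb_or => /andP[a1 a2].
    by have := I3 a; rewrite (negPf a1) (negPf a2) => /eqP <-.
  have S1 : ix1 \in S.
    move/fintype.subsetPn : N23 => [a aS]; rewrite !inE negb_or => /andP[a2 a3].
    by have := I3 a; rewrite (negPf a2) (negPf a3) => /orP[/eqP <-|].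
  have S2 : ix2 \notin S.
    apply: contra ST => S2; apply/eqP/setP => a; rewrite inE.
    by have /or3P[/eqP->|/eqP->|/eqP->] := I3 a.
  apply/setP => a; rewrite !inE; have /or3P[/eqP->|/eqP->|/eqP->] := I3 a.
  + by rewrite S1.
  + by rewrite (negPf S2).
  + by rewrite S3.
- move=> _ W om _ Hom c x u v Ac cW; split.
  + by rewrite (nabla1_0 HJ Hg HGam Hom Ac cW) mul0mx.
  + by rewrite (nabla2E HJ Hg HGam Hom Ac cW) scalemxAl.
  + by rewrite (nabla3E HJ Hg HGam Hom Ac cW) mulNmx scalemxAl.
  + exact: (om1_theta2 HJ Hg HGam Hom Ac cW u).
  + exact: (om1_theta3 HJ Hg HGam Hom Ac cW u).
Qed.
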